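(* Let $(R, M)$ be a pseudo-valuation domain with canonically associated valuation overring $(V, M)$, and let $R'$ be the integral closure of $R$ in $\mathrm{qf}(R)$. Put $K := R/M$, $L := R'/M$, and $F := V/M$. Then the following conditions are equivalent: (i) $R$ is a maximal non valuative subring of $V$; (ii) $R$ is a maximal non valuative domain; (iii) $R' = V$, $R\subset R'$ is a proper extension that is not a pointwise minimal extension, and for each ring $S$ such that $R\subset S\subseteq R'$, either $S = R'$ or $S\subset R'$ is a pointwise minimal extension; (iv) $L = F$, $K\subset L$ is a proper extension that is not a pointwise minimal extension, and for each ring $S$ such that $K\subset S\subseteq L$, either $S = L$ or $S\subset L$ is a pointwise minimal extension.
   Context: All rings are commutative with identity and are integral domains; $\mathrm{qf}(R)$ denotes the quotient field of $R$. The symbol $\subset$ denotes proper inclusion. An overring of $R$ is a subring of $\mathrm{qf}(R)$ containing $R$. An integral domain $R$ is a valuative domain if for each nonzero $x\in \mathrm{qf}(R)$, at least one of the extensions $R\subseteq R[x]$ and $R\subseteq R[x^{-1}]$ has no ring strictly between its two ends (equality of the two ends is allowed). A proper subring $R$ of an integral domain $T$ is a maximal non valuative subring of $T$ if $R$ is not a valuative domain but every subring of $T$ properly containing $R$ is a valuative domain. $R$ is a maximal non valuative domain if it is a maximal non valuative subring of $\mathrm{qf}(R)$. A proper ring extension $R\subset T$ is a minimal extension if there is no ring strictly between $R$ and $T$. A proper ring extension $R\subset T$ is a pointwise minimal extension if $R\subset R[x]$ is a minimal extension for each $x\in T\setminus R$. A domain $R$ is a pseudo-valuation domain if for every prime ideal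 $P$ of $R$ and all $x,y\in\mathrm{qf}(R)$ with $xy\in P$, either $x\in P$ or $y\in P$. Such an $R$ is local (has a unique maximal ideal $M$), and it has a canonically associated valuation overring $V$: a valuation overring of $R$ whose maximal ideal is also $M$ (every prime ideal of $R$ is then also a prime ideal of $V$). The ring $R'$ satisfies $R\subseteq R'\subseteq V$, so $M$ is an ideal of $R'$. Here $(R,M)$ means that $M$ is the unique maximal ideal of $R$. *)

(* Defs.v *)
From HB Require Import structures.
From mathcomp Require Import all_boot all_order all_algebra.
From mathcomp Require Import ring_quotient boolp.

Set Implicit Arguments.
Unset Strict Implicit.
Unset Printing Implicit Defensive.

Import GRing.Theory.
Local Open Scope ring_scope.
Local Open Scope quotient_scope.

(* Rings are subrings of an ambient commutative ring A, given by their boolean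
   membership predicates; equality of such rings is the extensional =i. *)

Record subring_of (A : comNzRingType) (S : subringClosed A) :=
  SubringOf { subring_val : A; subring_valP : subring_val \in S }.

HB.instance Definition _ (A : comNzRingType) (S : subringClosed A) :=
  [isSub of subring_of S for @subring_val A S].
HB.instance Definition _ (A : comNzRingType) (S : subringClosed A) :=
  [Choice of subring_of S by <:].
HB.instance Definition _ (A : comNzRingType) (S : subringClosed A) :=
  [SubChoice_isSubComNzRing of subring_of S by <:].

Section Extensions.
Variable A : comNzRingType.
Implicit Types (R S T : {pred A}) (x : A).

Definition psubset R T : Prop := {subset R <= T} /\ ~ (R =i T).

Definition has_intermediate_ring R T : Prop :=
  exists S : subringClosed A, psubset R S /\ psubset S T.

Definition adjoin R x : {pred A} :=
  fun y => `[< exists2 p : {poly A}, p \is a polyOver R & y = p.[x] >].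

Definition minimal_extension R T : Prop :=
  psubset R T /\ ~ has_intermediate_ring R T.

Definition pointwise_minimal_extension R T : Prop :=
  psubset R T /\
  forall x, x \in T -> x \notin R -> minimal_extension R (adjoin R x).

End Extensions.

(* Integral domains are subrings of an ambient field Q, and the quotient field
   of a domain is formed inside Q. *)
Section Domains.
Variable Q : fieldType.

Definition qf (R : {pred Q}) : {pred Q} :=
  fun x => `[< exists a b, [/\ a \in R, b \in R, b != 0 & x = a / b] >].

Definition valuative (R : {pred Q}) : Prop :=
  forall x, x \in qf R -> x != 0 ->
    ~ has_intermediate_ring R (adjoin R x) \/
    ~ has_intermediate_ring R (adjoin R x^-1).

Definition maximal_non_valuative_subring (R T : {pred Q}) : Prop :=
  [/\ psubset R T, ~ valuative R &
      forall S : subringClosed Q,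
        psubset R S -> {subset S <= T} -> valuative S].

Definition maximal_non_valuative_domain (R : {pred Q}) : Prop :=
  maximal_non_valuative_subring R (qf R).

Definition valuation_overring (R V : {pred Q}) : Prop :=
  [/\ {subset R <= V}, {subset V <= qf R} &
      forall x, x \in qf V -> x != 0 -> x \in V \/ x^-1 \in V].

Definition integral_closure (R : subringClosed Q) : {pred Q} :=
  fun x => `[< x \in qf R /\
               integralOver (\val : subring_of R -> Q) x >].

(* Ideals of R are represented as subsets of Q, so that one subset can be an
   ideal of several rings. *)
Definition trace_on (R : subringClosed Q) (I : {pred Q}) : {pred subring_of R} :=
  fun x => \val x \in I.
Arguments trace_on : clear implicits.

(* idealr_closed includes properness. *)
Definition proper_ideal_of (R : subringClosed Q) (I : {pred Q}) : Prop :=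
  {subset I <= R} /\ idealr_closed (trace_on R I).

Definition prime_ideal_of (R : subringClosed Q) (P : {pred Q}) : Prop :=
  proper_ideal_of R P /\ prime_idealr_closed (trace_on R P).

Definition maximal_ideal_of (R : subringClosed Q) (M : {pred Q}) : Prop :=
  proper_ideal_of R M /\
  forall I : {pred Q}, proper_ideal_of R I -> {subset M <= I} -> I =i M.

Definition local_with (R : subringClosed Q) (M : {pred Q}) : Prop :=
  maximal_ideal_of R M /\
  forall N : {pred Q}, maximal_ideal_of R N -> N =i M.

Definition pseudo_valuation (R : subringClosed Q) : Prop :=
  forall P : {pred Q}, prime_ideal_of R P ->
    forall x y, x \in qf R -> y \in qf R -> x * y \in P -> x \in P \/ y \in P.

Section Residue.
Variables (V : subringClosed Q) (M : {pred Q}) (locV : local_with V M).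

Definition max_ideal : idealr (subring_of V) :=
  HB.pack (trace_on V M) (isIdealr.Build (subring_of V) (trace_on V M) locV.1.1.2).

Definition residue_ring : comNzRingType := {ideal_quot max_ideal}.

(* S / M for M \subset S \subset V, identified with its canonical image in
   V / M. *)
Definition residue (S : {pred Q}) : {pred residue_ring} :=
  fun z => `[< exists2 v : subring_of V,
                 \val v \in S & z = \pi_({ideal_quot max_ideal}) v >].

End Residue.
End Domains.

Arguments trace_on {Q} R I.
Arguments max_ideal {Q V M} locV.
Arguments residue_ring {Q V M} locV.
Arguments residue {Q V M} locV S.

(* Main.v *)
(** Every overring of [R] is comparable to [V], and those containing [V] are
    valuation rings, so only the rings between [R] and [V] matter.  If some
    [t] in [V] is not integral over [R], its residue is transcendental over
    [R / M] and [R[t^4]] is not valuative; hence (ii) forces [R' = V].  Once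
    [R' = V], every [x] in [V] outside [M] is a unit of [V] with [x] and [x^-1]
    integral, so [S[x] = S[x^-1]] for each [S] between [R] and [V]; elements
    outside [V] have their inverse in [M].  Thus [S] is valuative exactly when
    [S[x]] is minimal over [S] for all [x] in [V] outside [S].  Rings between
    [R] and [V] correspond to rings between [K] and [F], compatibly with
    adjunction of an element. *)

Require Import Defs.
From HB Require Import structures.
From mathcomp Require Import all_boot all_order all_algebra.
From mathcomp Require Import ring_quotient boolp.
From mathcomp Require Import ring.

Set Implicit Arguments.
Unset Strict Implicit.
Unset Printing Implicit Defensive.

Import GRing.Theory.
Local Open Scope ring_scope.
Local Open Scope quotient_scope.

(** * Predicates and packed subrings *)

Lemma mem_eq_fun (T : Type) (P Q : {pred T}) : P =i Q -> P = Q.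
Proof. by move=> PQ; apply/funext => x; exact: PQ. Qed.

(** Equality of predicates, rather than [=i], lets a plain predicate such as [adjoin S x] be
    rewritten to a packed subring, where the [rpred] lemmas apply. *)
Lemma subring_pack (A : comNzRingType) (P : {pred A}) :
  subring_closed P -> exists S : subringClosed A, (S : {pred A}) = P.
Proof.
move=> cP; pose c := GRing.isSubringClosed.Build A P cP.
by exists (HB.pack_for (subringClosed A) P c).
Qed.

(** * Adjunction of one element and strict inclusions *)

Section Adjoin.
Variable A : comNzRingType.
Implicit Types (S T : subringClosed A) (x y : A).

Lemma adjoinP (S : {pred A}) x y :
  reflect (exists2 p : {poly A}, p \is a polyOver S & y = p.[x])
          (y \in adjoin S x).
Proof. exact: asboolP. Qed.

Lemma adjoin_subring_closed S x : subring_closed (adjoin S x).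
Proof.
split.
- by apply/adjoinP; exists 1; rewrite ?hornerC // rpred1.
- move=> _ _ /adjoinP[p pS ->] /adjoinP[q qS ->]; apply/adjoinP.
  by exists (p - q); rewrite ?rpredB // hornerD hornerN.
- move=> _ _ /adjoinP[p pS ->] /adjoinP[q qS ->]; apply/adjoinP.
  by exists (p * q); rewrite ?rpredM // hornerM.
Qed.

Lemma adjoin_sub S x : {subset S <= adjoin S x}.
Proof.
by move=> a aS; apply/adjoinP; exists a%:P; rewrite ?hornerC ?polyOverC.
Qed.

Lemma adjoin_mem S x : x \in adjoin S x.
Proof. by apply/adjoinP; exists 'X; rewrite ?hornerX ?polyOverX. Qed.

Lemma adjoin_min S T x :
  {subset S <= T} -> x \in T -> {subset adjoin S x <= T}.
Proof.
move=> ST xT _ /adjoinP[p /polyOverP pS ->].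
by rewrite horner_coef rpred_sum // => i _; rewrite rpredM ?rpredX // ST.
Qed.

Lemma adjoin_ring S x : exists T, (T : {pred A}) = adjoin S x.
Proof. exact/subring_pack/adjoin_subring_closed. Qed.

Lemma adjoin_id S x : x \in S -> adjoin S x = S.
Proof.
move=> xS; apply: mem_eq_fun => y; apply/idP/idP; first exact: adjoin_min.
exact: adjoin_sub.
Qed.

Lemma adjoin_eq S x y : x \in adjoin S y -> y \in adjoin S x ->
  adjoin S x = adjoin S y.
Proof.
have [Tx Ex] := adjoin_ring S x; have [Ty Ey] := adjoin_ring S y.
move=> xy yx; apply: mem_eq_fun => z; apply/idP/idP.
- by rewrite -Ey; apply: adjoin_min; rewrite Ey //; exact: adjoin_sub.
- by rewrite -Ex; apply: adjoin_min; rewrite Ex //; exact: adjoin_sub.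
Qed.

Lemma psubsetI (P P' : {pred A}) x :
  {subset P <= P'} -> x \in P' -> x \notin P -> psubset P P'.
Proof. by move=> sPP' xP' xP; split=> // PP'; rewrite PP' xP' in xP. Qed.

Lemma no_intermediate_refl (P : {pred A}) : ~ has_intermediate_ring P P.
Proof.
move=> [S [[PS nPS] [SP _]]]; apply: nPS => x.
by apply/idP/idP => [/PS|/SP].
Qed.

End Adjoin.

(** * Quotient fields, integrality and valuation rings *)

Section QuotientField.
Variable Q : fieldType.
Implicit Types (R S T : subringClosed Q) (x y : Q).

Lemma qfP (R : {pred Q}) x :
  reflect (exists a b, [/\ a \in R, b \in R, b != 0 & x = a / b])
          (x \in qf R).
Proof. exact: asboolP. Qed.

Lemma qf_sub R : {subset R <= qf R}.
Proof.
move=> x xR; apply/qfP; exists x, 1.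
by rewrite xR rpred1 oner_neq0 divr1.
Qed.

Lemma qfS (P P' : {pred Q}) : {subset P <= P'} -> {subset qf P <= qf P'}.
Proof.
move=> PP' x /qfP[a [b [aP bP b0 ->]]]; apply/qfP; exists a, b.
by split=> //; exact: PP'.
Qed.

Lemma qf_div R x y : x \in qf R -> y \in qf R -> x / y \in qf R.
Proof.
move=> /qfP[a [b [aR bR b0 ->]]] /qfP[c [d [cR dR d0 ->]]].
have [->|c0] := eqVneq c 0.
  rewrite mul0r invr0 mulr0; apply: qf_sub; exact: rpred0.
apply/qfP; exists (a * d), (b * c); split; rewrite ?rpredM ?mulf_neq0 //.
by field; rewrite b0 c0 d0.
Qed.

Lemma qf_qf R (P : {pred Q}) : {subset P <= qf R} -> {subset qf P <= qf R}.
Proof.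
by move=> PR x /qfP[a [b [/PR aR /PR bR _ ->]]]; exact: qf_div.
Qed.

(** Trades polynomials over the type [subring_of R] for polynomials over [Q] with coefficients in
    [R]. *)
Lemma integral_closureP R x :
  reflect (x \in qf R /\
           exists p : {poly Q}, [/\ p \is a polyOver R, p \is monic & p.[x] = 0])
          (x \in integral_closure R).
Proof.
apply: (iffP (asboolP _)) => -[xR].
  move=> [p mp /rootP px]; split=> //; exists (map_poly \val p).
  split=> //; last exact: monic_map.
  by apply/polyOverP => i; rewrite coef_map; case: (p`_i).
move=> [p [/polyOverP pR mp px]]; split=> //.
(* The default [0] of [insubd] is never reached, all coefficients of [p] being in [R]. *)
pose q : {poly subring_of R} := \poly_(i < size p) insubd 0 p`_i.
have valq : map_poly \val q = p.
  apply/polyP => i; rewrite coef_map coef_poly; case: ltnP => [_|le].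
    by rewrite /= insubdK // pR.
  by rewrite nth_default.
exists q; last by rewrite valq; apply/rootP.
have sq : size q = size p.
  apply: size_poly_eq; rewrite -val_eqE /= insubdK ?pR //.
  rewrite -lead_coefE (monicP mp); exact: oner_neq0.
rewrite monicE lead_coefE sq coef_poly prednK ?leqnn ?size_poly_gt0 ?monic_neq0 //.
by rewrite -val_eqE /= insubdK ?pR // -lead_coefE (monicP mp).
Qed.

(* Dividing the integral equation of [x] by [x ^+ n.-1] expresses [x] as a
   polynomial in [x^-1]. *)
Lemma integral_mem_inv R T x :
  {subset R <= T} -> x \in integral_closure R -> x != 0 -> x^-1 \in T ->
  x \in T.
Proof.
move=> RT /integral_closureP[_ [p [/polyOverP pR mp px]]] x0 xVT.
case sp : (size p) (monic_neq0 mp) => [|n] p0.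
  by move/eqP: sp; rewrite size_poly_eq0 (negPf p0).
move: px; rewrite horner_coef sp big_ord_recr /=.
have -> : p`_n = 1 by rewrite -(monicP mp) lead_coefE sp.
rewrite mul1r => /eqP; rewrite addrC addr_eq0 => /eqP xn.
(* A monic polynomial of size one is [1] and has no root, so the degree is positive. *)
case: n sp xn => [|n] sp xn.
  by move: xn; rewrite big_ord0 oppr0 expr0 => /eqP; rewrite oner_eq0.
have -> : x = x ^+ n.+1 * x^-1 ^+ n.
  by rewrite exprS -mulrA -exprMn divff // expr1n mulr1.
rewrite xn mulNr mulr_suml rpredN.
apply: rpred_sum => i _; rewrite -mulrA.
have le_in : (i <= n)%N by rewrite -ltnS.
(* As [i <= n], the product of [x ^+ i] and [x^-1 ^+ n] is a nonnegative power of [x^-1]. *)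
have -> : x^-1 ^+ n = x^-1 ^+ i * x^-1 ^+ (n - i) by rewrite -exprD subnKC.
rewrite [x ^+ i * _]mulrA -exprMn divff // expr1n mul1r.
by rewrite rpredM ?rpredX // RT.
Qed.

(** One of the two adjunctions is trivial, and nothing lies strictly between a ring and itself. *)
Lemma valuative_of_valuation S :
  (forall x, x \in qf S -> x != 0 -> x \in S \/ x^-1 \in S) -> valuative S.
Proof.
move=> vS x xS x0; have [xin|xin] := vS x xS x0; [left|right];
by rewrite adjoin_id //; exact: no_intermediate_refl.
Qed.

End QuotientField.

(** * A ring and a valuation overring sharing a maximal ideal *)

Section CommonMaximalIdeal.
Variables (Q : fieldType) (R V : subringClosed Q) (M : {pred Q}).
Hypotheses (maxR : maximal_ideal_of R M) (maxV : maximal_ideal_of V M).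
Hypothesis valV : valuation_overring R V.
Implicit Types (S T : subringClosed Q) (x y m v : Q).

Let RV : {subset R <= V}. Proof. by case: valV. Qed.
Let VR : {subset V <= qf R}. Proof. by case: valV. Qed.
Let MR : {subset M <= R}. Proof. by case: maxR => -[]. Qed.
Let MV : {subset M <= V}. Proof. by case: maxV => -[]. Qed.

Lemma ideal0 : 0 \in M.
Proof. by have [[_ [h _ _]] _] := maxV; move: h; rewrite unfold_in. Qed.

Lemma ideal1 : 1 \notin M.
Proof. by have [[_ [_ h _]] _] := maxV; move: h; rewrite unfold_in. Qed.

Lemma ideal_lin a x y : a \in V -> x \in M -> y \in M -> a * x + y \in M.
Proof.
move=> aV xM yM; have [[_ [_ _ h]] _] := maxV.
by have := h (SubringOf aV) (SubringOf (MV xM)) (SubringOf (MV yM)) xM yM.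
Qed.

Lemma idealM a x : a \in V -> x \in M -> a * x \in M.
Proof. by move=> aV xM; rewrite -[_ * _]addr0 ideal_lin // ideal0. Qed.

Lemma idealB x y : x \in M -> y \in M -> x - y \in M.
Proof.
by move=> xM yM; rewrite addrC -mulN1r ideal_lin // rpredN rpred1.
Qed.

Lemma valuation_case x : x \in qf R -> x \in V \/ x^-1 \in V.
Proof.
have [_ _ h] := valV => xR.
have [->|x0] := eqVneq x 0; first by left; exact: rpred0.
by apply: h => //; exact: qfS xR.
Qed.

Lemma unit_notin_ideal x : x \in V -> x^-1 \in V -> x != 0 -> x \notin M.
Proof.
move=> xV xVV x0; apply/negP => xM; have := ideal1.
by rewrite -(mulVf x0) idealM.
Qed.

(* The nonunits of the valuation ring form a proper ideal containing [M],
   hence equal to it. *)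
Lemma nonunit_ideal x : x \in V -> x^-1 \notin V -> x \in M.
Proof.
(* Zero is listed apart because its inverse is [0] by convention, which lies in [V]. *)
pose I : {pred Q} := [pred y | (y \in V) && ((y == 0) || (y^-1 \notin V))].
suff IM : I =i M by move=> xV xVV; rewrite -IM inE xV xVV orbT.
have IV : {subset I <= V} by move=> y /andP[].
have Imul a y : a \in V -> y \in I -> a * y \in I.
  move=> aV; rewrite !inE => /andP[yV /orP[/eqP->|yVV]].
    by rewrite mulr0 rpred0 eqxx.
  rewrite rpredM //=; have [->//|ay0 /=] := eqVneq (a * y) 0.
  apply/negP => h; case/negP: yVV.
  move: ay0; rewrite mulf_eq0 negb_or => /andP[a0 y0].
  have -> : y^-1 = a * (a * y)^-1 by rewrite invfM mulrA divff // mul1r.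
  exact: rpredM.
have Iadd y z : y \in I -> z \in I -> y + z \in I.
  have [->|y0] := eqVneq y 0; first by rewrite add0r.
  have [->|z0] := eqVneq z 0; first by rewrite addr0.
  move=> yI zI.
  (* Whichever quotient lies in [V], the sum is a [V]-multiple of [z] or of [y]. *)
  have [yz|zy] : y / z \in V \/ (y / z)^-1 \in V.
  - by apply: valuation_case; apply: qf_div; apply/VR/IV.
  - have -> : y + z = (y / z + 1) * z by rewrite mulrDl mul1r divfK.
    by apply: Imul; rewrite ?rpredD ?rpred1.
  - have -> : y + z = ((y / z)^-1 + 1) * y.
      by rewrite mulrDl mul1r invf_div divfK // addrC.
    by apply: Imul; rewrite ?rpredD ?rpred1.
have [_ mx] := maxV; apply: mx; last first.
  move=> y yM; rewrite inE MV //=.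
  have [//|y0] := eqVneq y 0.
  by apply/negP => h; have := unit_notin_ideal (MV yM) h y0; rewrite yM.
split=> //; split.
- have : 0 \in I by rewrite inE rpred0 eqxx.
  exact.
- have : 1 \notin I by rewrite inE rpred1 oner_eq0 invr1 rpred1.
  exact.
- move=> a u v uI vI; apply: Iadd => //; apply: Imul => //; exact: valP.
Qed.

Lemma notin_valuation_inv x : x \in qf R -> x \notin V -> x^-1 \in M.
Proof.
move=> xR xV; have [h|h] := valuation_case xR; first by rewrite h in xV.
by rewrite nonunit_ideal // invrK.
Qed.

Lemma notin_ideal_inv x : x \in V -> x \notin M -> x^-1 \in V.
Proof. by move=> xV; apply: contraR => /(nonunit_ideal xV). Qed.

(* By maximality [1 = m + r * a] with [m \in M] and [a \in R], and [1 - m] is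
   already a unit of [R]. *)
Lemma base_unit (r : Q) : r \in R -> r \notin M -> r^-1 \in R.
Proof.
move=> rR rM.
have r0 : r != 0 by apply: contra rM => /eqP ->; exact: ideal0.
pose I : {pred Q} :=
  fun y => `[< exists m a, [/\ m \in M, a \in R & y = m + r * a] >].
have IP y : reflect (exists m a, [/\ m \in M, a \in R & y = m + r * a]) (y \in I).
  exact: asboolP.
have MI : {subset M <= I}.
  by move=> m mM; apply/IP; exists m, 0; rewrite mM rpred0 mulr0 addr0.
(* Otherwise [I] is a proper ideal of [R] containing [M], hence equal to [M], although it contains
   [r]. *)
have idI : 1 \in I.
  apply: contraNT rM => I1; have [_ mx] := maxR; rewrite -(mx I _ MI).
    by apply/IP; exists 0, 1; rewrite ideal0 rpred1 add0r mulr1.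
  split; first by move=> y /IP[m [a [mM aR ->]]]; rewrite rpredD ?rpredM // MR.
  split=> //; first exact: (MI _ ideal0).
  move=> c u v /IP[m [a [mM aR eu]]] /IP[m' [a' [mM' aR' ev]]].
  have cR := valP c.
  apply/IP; rewrite /= eu ev.
  exists (\val c * m + m'), (\val c * a + a'); split; last first.
    by rewrite !mulrDr mulrCA addrACA.
    by rewrite rpredD ?rpredM.
  by apply: ideal_lin => //; exact: RV.
have [m [a [mM aR e1]]] := IP _ idI.
have m1 : 1 - m \notin M.
  apply/negP => h; have := ideal1; rewrite -(subrK m 1) -[m in _ + m]opprK.
  by rewrite idealB // -sub0r idealB // ideal0.
have n0 : 1 - m != 0 by apply: contra m1 => /eqP ->; exact: ideal0.
have uV : (1 - m)^-1 \in V.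
  by apply: notin_ideal_inv => //; rewrite rpredB ?rpred1 ?MV.
(* The inverse exists in [V] and differs from [1] by an element of [M], since [M] is an ideal of
   [V]; and [M] is contained in [R]. *)
have uR : (1 - m)^-1 \in R.
  have -> : (1 - m)^-1 = 1 + (1 - m)^-1 * m by field.
  by rewrite rpredD ?rpred1 // MR // idealM.
have -> : r^-1 = a * (1 - m)^-1; last exact: rpredM.
have ra : r * a = 1 - m by rewrite {1}e1 addrC addKr.
by apply: (mulfI r0); rewrite mulrA ra !divff.
Qed.

(** If [S] has an element [x] outside [V], then [x^-1] is in [M], so each [v] in [V] is [x] times an
    element of [M], which lies in [R]. *)
Lemma overring_comparable S :
  {subset R <= S} -> {subset S <= qf R} ->
  {subset S <= V} \/ {subset V <= S}.
Proof.
move=> RS SR; have [|/existsNP[x /not_implyP[xS /negP xV]]] :=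
  pselect (forall x, x \in S -> x \in V); [by left|right => v vV].
have xM : x^-1 \in M by apply: notin_valuation_inv => //; exact: SR.
have x0 : x != 0 by apply: contraNneq xV => ->; rewrite rpred0.
have -> : v = v * x^-1 * x by rewrite mulfVK.
by rewrite rpredM // RS // MR // idealM.
Qed.

Lemma overring_of_valuation_valuative S :
  {subset V <= S} -> {subset S <= qf R} -> valuative S.
Proof.
move=> VS SR; apply: valuative_of_valuation => x xS x0.
have [h|h] := valuation_case (qf_qf SR xS); [left|right]; exact: VS.
Qed.

(** An integral [x] outside [V] would have its inverse in [V], and integrality would then bring [x]
    back into [V]. *)
Lemma integral_closure_sub : {subset integral_closure R <= V}.
Proof.
move=> x xI; have xR : x \in qf R by case/integral_closureP: xI.
apply: contraT => xV.
have x0 : x != 0 by apply: contraNneq xV => ->; rewrite rpred0.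
have := integral_mem_inv RV xI x0 (MV (notin_valuation_inv xR xV)).
by rewrite (negPf xV).
Qed.

(** Both [x] and [x^-1] lie in [V], so both are integral over [R], and each is a polynomial in the
    other. *)
Lemma adjoin_inv S x : integral_closure R =i V -> {subset R <= S} ->
  x \in V -> x \notin M -> adjoin S x^-1 = adjoin S x.
Proof.
move=> RI RS xV xM.
have x0 : x != 0 by apply: contra xM => /eqP ->; exact: ideal0.
have RT y : {subset R <= adjoin S y}.
  by move=> z /RS; exact: adjoin_sub.
apply: adjoin_eq.
- have [T ET] := adjoin_ring S x; rewrite -ET.
  apply: (@integral_mem_inv _ R); rewrite ?invr_eq0 ?invrK ?ET //.
  + by rewrite RI; exact: notin_ideal_inv.
  + exact: adjoin_mem.
- have [T ET] := adjoin_ring S x^-1; rewrite -ET.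
  apply: (@integral_mem_inv _ R); rewrite ?RI ?ET //; exact: adjoin_mem.
Qed.

(* Modulo [M] the relation [p.[t] \in M] is a nontrivial algebraic equation
   over the field [R / M]; we normalise its leading coefficient. *)
Lemma integral_of_relation p t : t \in V -> p \is a polyOver R ->
  p.[t] \in M -> (exists i, p`_i \notin M) -> t \in integral_closure R.
Proof.
move=> tV; elim: {p}(size p) {-2}p (leqnn (size p)) => [|n IH] p sp /polyOverP pR.
  move=> _ [i]; rewrite nth_default ?ideal0 //; exact: leq_trans sp _.
move=> ptM ex; have [pnM|pnM] := boolP (p`_n \in M).
  have qM : (p - p`_n *: 'X^n).[t] \in M.
    rewrite hornerD hornerN hornerZ hornerXn idealB //.
    by rewrite mulrC idealM // rpredX.
  apply: (IH (p - p`_n *: 'X^n)) => //.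
  - apply/leq_sizeP => j; rewrite leq_eqVlt coefB coefZ coefXn.
    case/orP => [/eqP <-|nj]; first by rewrite eqxx mulr1 subrr.
    by rewrite gtn_eqF // mulr0 subr0 nth_default //; exact: leq_trans nj.
  - by rewrite rpredB ?polyOverZ ?rpredX ?polyOverX //; apply/polyOverP.
  - have [i piM] := ex; exists i; rewrite coefB coefZ coefXn.
    have [ein|] := eqVneq i n; first by rewrite -ein (negPf piM) in pnM.
    by rewrite mulr0 subr0.
have pn0 : p`_n != 0 by apply: contra pnM => /eqP ->; exact: ideal0.
have uR := base_unit (pR n) pnM.
(* A constant polynomial would have its coefficient [p.[t]] in [M]. *)
case: n => [|n] in sp pnM pn0 uR IH *.
  by move: ptM; rewrite (size1_polyC sp) hornerC (negPf pnM).
have spn : size p = n.+2.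
  by apply/eqP; rewrite eqn_leq sp ltnNge; apply: contra pn0 => /leq_sizeP ->.
(* Since [c] is in [M], hence in [R], it can be subtracted as a constant, which makes [t] a root. *)
set c := (p`_n.+1)^-1 * p.[t].
have cM : c \in M by apply: idealM => //; exact: RV.
apply/integral_closureP; split; first exact: VR.
exists ((p`_n.+1)^-1 *: p - c%:P); split.
- by rewrite rpredB ?polyOverZ ?polyOverC //; [exact/polyOverP | exact: MR].
- have sz : size ((p`_n.+1)^-1 *: p) = n.+2 by rewrite size_scale ?invr_eq0.
  rewrite monicE lead_coefDl ?sz ?size_polyN; last first.
    exact: leq_ltn_trans (size_polyC_leq1 _) _.
  by rewrite lead_coefZ lead_coefE spn mulVf.
- by rewrite hornerD hornerN hornerC hornerZ subrr.
Qed.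

(** * Elements of the valuation ring that are not integral *)

Lemma power_notin_adjoin t j k : t \in V -> t \notin integral_closure R ->
  (0 < k)%N -> ~~ (k %| j)%N -> t ^+ j \notin adjoin R (t ^+ k).
Proof.
move=> tV tI k0 kj; apply: contra tI => /adjoinP[q qR tj].
(* The polynomial vanishes at [t], and its coefficient of degree [j] is [1] because only multiples
   of [k] occur in the composition. *)
apply: (@integral_of_relation ('X^j - (q \Po 'X^k))) => //.
- by rewrite rpredB ?polyOver_comp ?rpredX ?polyOverX.
- by rewrite hornerD hornerN hornerXn horner_comp hornerXn -tj subrr ideal0.
- exists j; rewrite coefB coefXn eqxx coef_comp_poly_Xn // (negPf kj) subr0.
  exact: ideal1.
Qed.

(** For nonzero [s] the predicate describes [S[s^-1]]; two denominators are merged by adding their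
    exponents. *)
Lemma localization_subring_closed (S : subringClosed Q) (s : Q) : s \in S ->
  subring_closed [pred y | `[< exists n, y * s ^+ n \in S >]].
Proof.
move=> sS; split.
- by rewrite inE; apply/asboolP; exists 0%N; rewrite mulr1 rpred1.
- move=> y z /asboolP[m ym] /asboolP[n zn]; rewrite inE; apply/asboolP.
  exists (m + n)%N; rewrite mulrBl {2}addnC !exprD !mulrA.
  by rewrite rpredB // rpredM // rpredX.
- move=> y z /asboolP[m ym] /asboolP[n zn]; rewrite inE; apply/asboolP.
  by exists (m + n)%N; rewrite exprD mulrACA rpredM.
Qed.

(* The chains [R[t^4] < R[t^2] < R[t]] and
   [R[t^4] < R[t^2, t^-2] < R[t^4, t^-1]] are strict. *)
Lemma adjoin_transcendental_not_valuative t S :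
  t \in V -> t \notin integral_closure R ->
  (S : {pred Q}) = adjoin R (t ^+ 4) -> ~ valuative S.
Proof.
move=> tV tI ES vS.
have t0 : t != 0.
  apply: contraNneq tI => ->; apply/integral_closureP; split.
    by apply/VR; exact: rpred0.
  by exists 'X; rewrite polyOverX monicX hornerX.
have RS : {subset R <= S} by rewrite ES; exact: adjoin_sub.
have t4S : t ^+ 4 \in S by rewrite ES adjoin_mem.
have [T ET] := adjoin_ring R (t ^+ 2).
have RT : {subset R <= T} by rewrite ET; exact: adjoin_sub.
have t2T : t ^+ 2 \in T by rewrite ET adjoin_mem.
have ST : {subset S <= T}.
  by rewrite ES; apply: adjoin_min => //; rewrite (exprM t 2 2) rpredX.
have t2S : t ^+ 2 \notin S by rewrite ES power_notin_adjoin.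
(* All odd powers are needed: if [t^-1] were in the localization of [T] at [t ^+ 2], some
   unspecified odd power of [t] would be in [T]. *)
have tT n : t ^+ (2 * n).+1 \notin T.
  by rewrite ET power_notin_adjoin // dvdn2 /= oddM.
have tR : t \in qf R by exact: VR.
have [] := vS t (qfS RS tR) t0.
- apply; exists T; split; first exact: psubsetI ST t2T t2S.
  have [T' ET'] := adjoin_ring S t.
  have tT' : t \in T' by rewrite ET' adjoin_mem.
  have ST' : {subset S <= T'} by rewrite ET'; exact: adjoin_sub.
  rewrite -ET'; apply: (psubsetI _ tT' (tT 0%N)).
  by rewrite ET; apply: adjoin_min; rewrite ?rpredX // => r /RS /ST'.
(* [B] is the ring [R[t^2, t^-2]], the middle term of the second chain. *)
- apply; have [B EB] := subring_pack (localization_subring_closed t2T).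
  have BP y : reflect (exists n, y * (t ^+ 2) ^+ n \in T) (y \in B).
    by rewrite EB; exact: asboolP.
  have SB : {subset S <= B}.
    by move=> y yS; apply/BP; exists 0%N; rewrite mulr1 ST.
  exists B; split.
    apply: (@psubsetI _ _ _ (t ^+ 2)^-1) => //.
      by apply/BP; exists 1%N; rewrite mulVf ?expf_neq0 // rpred1.
    apply: contra t2S => h; have -> : t ^+ 2 = t ^+ 4 * (t ^+ 2)^-1.
      by rewrite (exprD t 2 2) mulfK // expf_neq0.
    exact: rpredM.
  have [T' ET'] := adjoin_ring S t^-1.
  have tT' : t^-1 \in T' by rewrite ET' adjoin_mem.
  have ST' : {subset S <= T'} by rewrite ET'; exact: adjoin_sub.
  rewrite -ET'; apply: (psubsetI _ tT').
  - have TT' : {subset T <= T'}.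
      rewrite ET; apply: adjoin_min => [r /RS /ST' //|].
      have -> : t ^+ 2 = t ^+ 4 * t^-1 ^+ 2.
        by rewrite (exprD t 2 2) exprVn mulfK // expf_neq0.
      by apply: rpredM; [exact: ST' | exact: rpredX].
    move=> y /BP[n yn]; have -> : y = y * (t ^+ 2) ^+ n * (t^-1 ^+ 2) ^+ n.
      by rewrite -mulrA -exprMn -exprMn divff // !expr1n mulr1.
    by rewrite rpredM ?rpredX // TT'.
  - apply/negP => /BP[n h]; have := tT n; rewrite exprSr exprM.
    have -> : (t ^+ 2) ^+ n * t = t ^+ 2 * (t^-1 * (t ^+ 2) ^+ n).
      by rewrite mulrA expr2 mulfK // mulrC.
    by rewrite rpredM.
Qed.

(** * Valuative domains and minimal extensions *)

Lemma minimal_of_valuative S x : integral_closure R =i V ->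
  {subset R <= S} -> valuative S -> x \in V -> x \notin S ->
  minimal_extension S (adjoin S x).
Proof.
move=> RI RS vS xV xS; split.
  by apply: psubsetI (adjoin_mem S x) xS; exact: adjoin_sub.
(* Being outside [M], [x] is a unit of [V], so both alternatives of [valuative] concern the same
   extension. *)
have xM : x \notin M by apply: contra xS => /MR /RS.
have x0 : x != 0 by apply: contra xM => /eqP ->; exact: ideal0.
have xq : x \in qf S by apply: (qfS RS); exact: VR.
by case: (vS x xq x0) => //; rewrite (adjoin_inv RI RS xV xM).
Qed.

(** Only elements of [V] outside [S] need the assumption: an [x] in [S] gives a trivial extension,
    and an [x] outside [V] has its inverse in [M], hence in [S]. *)
Lemma valuative_of_minimal S :
  {subset R <= S} -> {subset S <= V} ->
  (forall x, x \in V -> x \notin S -> minimal_extension S (adjoin S x)) ->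
  valuative S.
Proof.
move=> RS SV mS x xS x0.
have xR : x \in qf R by apply: (qf_qf _ xS) => y /SV /VR.
have [xinS|xnS] := boolP (x \in S).
  by left; rewrite adjoin_id //; exact: no_intermediate_refl.
have [xV|xV] := boolP (x \in V); first by left; case: (mS x xV xnS).
right; rewrite adjoin_id; first exact: no_intermediate_refl.
by apply/RS/MR; exact: notin_valuation_inv.
Qed.

(** An overring that is not inside [V] contains [V] and is therefore valuative. *)
Lemma mnv_domain_of_mnv_subring :
  maximal_non_valuative_subring R V -> maximal_non_valuative_domain R.
Proof.
move=> [[_ /= nRV] nvR hS]; split=> //.
  split; first exact: qf_sub.
  move=> Rqf; apply: nRV => x.
  by apply/idP/idP => [/RV //|/VR]; rewrite Rqf.
move=> S RS SR; have [h|h] := overring_comparable RS.1 SR; first exact: hS.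
exact: overring_of_valuation_valuative.
Qed.

(** A nonintegral [t] in [V] would make [R[t^4]] a nonvaluative ring properly containing [R]. *)
Lemma integral_closure_of_mnv_domain :
  maximal_non_valuative_domain R -> integral_closure R =i V.
Proof.
move=> [_ _ hS] t; apply/idP/idP => [|tV]; first exact: integral_closure_sub.
apply: contraT => tI; have [S ES] := adjoin_ring R (t ^+ 4).
case: (adjoin_transcendental_not_valuative tV tI ES); apply: hS.
  rewrite ES.
  apply: psubsetI (adjoin_mem _ _) _; first exact: adjoin_sub.
  (* The extension is proper: if [t ^+ 4] were in [R], then [t] would be a root of a monic binomial
     over [R]. *)
  apply: contra tI => t4R; apply/integral_closureP; split; first exact: VR.
  exists ('X^4 - (t ^+ 4)%:P); rewrite monicXnsubC //.
  rewrite polyOverXnsubC.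
  by rewrite hornerD hornerN hornerC hornerXn subrr.
by rewrite ES => x xS; apply/VR; apply: adjoin_min xS => //; exact: rpredX.
Qed.

(** Once [V] is the integral closure, valuativity of a ring below it amounts to minimality of its
    simple extensions inside [V]. Also [R] differs from [V], since [V] is valuative. *)
Lemma pointwise_minimal_of_mnv_domain :
  maximal_non_valuative_domain R ->
  [/\ integral_closure R =i V,
      psubset R (integral_closure R),
      ~ pointwise_minimal_extension R (integral_closure R) &
      forall S : subringClosed Q,
        psubset R S -> {subset S <= integral_closure R} ->
        S =i integral_closure R \/
        pointwise_minimal_extension S (integral_closure R)].
Proof.
move=> mnv; have RI := integral_closure_of_mnv_domain mnv.
have {mnv} [_ nvR hS] := mnv; rewrite (mem_eq_fun RI); split=> //.
- split=> // RV'; apply: nvR; apply: overring_of_valuation_valuative.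
    by move=> x; rewrite RV'.
  exact: qf_sub.
- by case=> _ pm; apply/nvR/valuative_of_minimal.
- move=> S RS SV; have [SV'|nSV] := pselect (S =i V); [by left|right].
  split=> // x xV xS; apply: minimal_of_valuative => //; first exact: RS.1.
  by apply: hS => // y /SV /VR.
Qed.

(** The same dictionary read backwards; the case [S = V] is that of a valuation ring. *)
Lemma mnv_subring_of_pointwise_minimal :
  [/\ integral_closure R =i V,
      psubset R (integral_closure R),
      ~ pointwise_minimal_extension R (integral_closure R) &
      forall S : subringClosed Q,
        psubset R S -> {subset S <= integral_closure R} ->
        S =i integral_closure R \/
        pointwise_minimal_extension S (integral_closure R)] ->
  maximal_non_valuative_subring R V.
Proof.
move=> [RI]; rewrite (mem_eq_fun RI) => psRV npm hS; split=> //.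
  move=> vR; apply: npm; split=> // x xV xR; exact: minimal_of_valuative.
move=> S RS SV; have [SV'|[_ pm]] := hS S RS SV.
  apply: overring_of_valuation_valuative => x; first by rewrite SV'.
  by move/SV/VR.
by apply: valuative_of_minimal => //; exact: RS.1.
Qed.

End CommonMaximalIdeal.

(** * Rings between [M] and [V] and subrings of [V / M] *)

Section ResidueCorrespondence.
Variables (Q : fieldType) (V : subringClosed Q) (M : {pred Q}).
Variable locV : local_with V M.
Implicit Types (S : subringClosed Q) (T : subringClosed (residue_ring locV)).
Implicit Types (v w : subring_of V).

Let MV : {subset M <= V}. Proof. by case: locV => -[[]]. Qed.

Local Notation pi := (\pi_({ideal_quot max_ideal locV})).

Lemma pi_eqP v w : reflect (pi v = pi w) (\val v - \val w \in M).
Proof.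
have -> : (\val v - \val w \in M) = (v - w \in max_ideal locV) by [].
by rewrite Quotient.idealrBE; exact: eqP.
Qed.

Lemma residueP (P : {pred Q}) z :
  reflect (exists2 v, \val v \in P & z = pi v) (z \in residue locV P).
Proof. exact: asboolP. Qed.

(** Two representatives of a class differ by an element of [M], which [S] contains. *)
Lemma mem_residue S v : {subset M <= S} ->
  (pi v \in residue locV S) = (\val v \in S).
Proof.
move=> MS; apply/residueP/idP => [[w wS /pi_eqP vw]|]; last by exists v.
by rewrite -(subrK (\val w) (\val v)) rpredD // MS.
Qed.

Lemma residue_subring_closed S : subring_closed (residue locV S).
Proof.
split.
- by apply/residueP; exists 1; rewrite ?rmorph1 // rpred1.
- move=> _ _ /residueP[v vS ->] /residueP[w wS ->]; apply/residueP.
  by exists (v - w); rewrite ?rmorphB // rpredB.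
- move=> _ _ /residueP[v vS ->] /residueP[w wS ->]; apply/residueP.
  by exists (v * w); rewrite ?rmorphM // rpredM.
Qed.

Lemma residue_subring S : exists T, (T : {pred _}) = residue locV S.
Proof. exact/subring_pack/residue_subring_closed. Qed.

Definition residue_preimage (P : {pred residue_ring locV}) : {pred Q} :=
  fun x => `[< exists2 v : subring_of V, \val v = x & pi v \in P >].

Lemma residue_preimageP (P : {pred residue_ring locV}) x :
  reflect (exists2 v, \val v = x & pi v \in P) (x \in residue_preimage P).
Proof. exact: asboolP. Qed.

Lemma mem_residue_preimage (P : {pred residue_ring locV}) v :
  (\val v \in residue_preimage P) = (pi v \in P).
Proof.
by apply/residue_preimageP/idP => [[w /val_inj ->]|]; last by exists v.
Qed.

Lemma residue_preimage_sub (P : {pred residue_ring locV}) :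
  {subset residue_preimage P <= V}.
Proof. by move=> _ /residue_preimageP[v <- _]; exact: valP. Qed.

Lemma residue_preimageK (P : {pred residue_ring locV}) :
  residue locV (residue_preimage P) = P.
Proof.
apply: mem_eq_fun => z; apply/residueP/idP => [[v vP ->]|zP].
  by rewrite -mem_residue_preimage.
by exists (repr z); rewrite ?reprK // mem_residue_preimage reprK.
Qed.

Lemma ideal_sub_residue_preimage T : {subset M <= residue_preimage T}.
Proof.
move=> m mM; apply/residue_preimageP; exists (SubringOf (MV mM)) => //.
have -> : pi (SubringOf (MV mM)) = pi 0 by apply/pi_eqP; rewrite /= subr0.
by rewrite rmorph0 rpred0.
Qed.

Lemma residue_preimage_subring_closed T : subring_closed (residue_preimage T).
Proof.
split.
- apply/residue_preimageP; exists 1 => //; by rewrite rmorph1 rpred1.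
- move=> _ _ /residue_preimageP[v <- vT] /residue_preimageP[w <- wT].
  by apply/residue_preimageP; exists (v - w) => //; rewrite rmorphB rpredB.
- move=> _ _ /residue_preimageP[v <- vT] /residue_preimageP[w <- wT].
  by apply/residue_preimageP; exists (v * w) => //; rewrite rmorphM rpredM.
Qed.

Lemma residue_surj T :
  exists S, [/\ {subset M <= S}, {subset S <= V} & residue locV S = T].
Proof.
have [S ES] := subring_pack (residue_preimage_subring_closed T).
exists S; rewrite ES; split; [exact: ideal_sub_residue_preimage | |].
  exact: residue_preimage_sub.
exact: residue_preimageK.
Qed.

Lemma residue_subE (S S' : subringClosed Q) :
  {subset M <= S} -> {subset M <= S'} -> {subset S <= V} ->
  {subset residue locV S <= residue locV S'} <-> {subset S <= S'}.
Proof.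
move=> MS MS' SV; split=> [h x xS|h _ /residueP[v vS ->]].
  have := h (pi (SubringOf (SV _ xS))).
  by rewrite !mem_residue //; exact.
by apply/residueP; exists v => //; exact: h.
Qed.

Lemma residue_inj (S S' : subringClosed Q) :
  {subset M <= S} -> {subset M <= S'} -> {subset S <= V} -> {subset S' <= V} ->
  residue locV S =i residue locV S' <-> S =i S'.
Proof.
move=> MS MS' SV SV'; split=> [h x|/mem_eq_fun -> //].
by apply/idP/idP; apply: (residue_subE _ _ _).1 => // z; rewrite h.
Qed.

Lemma residue_psubset (S S' : subringClosed Q) :
  {subset M <= S} -> {subset M <= S'} -> {subset S <= V} -> {subset S' <= V} ->
  psubset (residue locV S) (residue locV S') <-> psubset S S'.
Proof.
move=> MS MS' SV SV'; have sub := residue_subE MS MS' SV.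
have inj := residue_inj MS MS' SV SV'.
by split=> -[/sub ? ne]; split=> // /inj.
Qed.

(** Both inclusions follow from minimality of an adjunction: the image of [S[v]] contains the
    residues of [S] and [v], while the preimage [B] of the adjunction downstairs contains [S] and
    [v]. *)
Lemma residue_adjoin S v : {subset M <= S} -> {subset S <= V} ->
  residue locV (adjoin S (\val v)) = adjoin (residue locV S) (pi v).
Proof.
move=> MS SV; have [A EA] := adjoin_ring S (\val v).
have [K EK] := residue_subring S; have [T ET] := adjoin_ring K (pi v).
have [T' ET'] := residue_subring A; have [B [MB BV EB]] := residue_surj T.
have SA : {subset S <= A} by rewrite EA; exact: adjoin_sub.
have MA : {subset M <= A} by move=> m /MS /SA.
have vA : \val v \in A by rewrite EA adjoin_mem.
have AV : {subset A <= V} by rewrite EA; apply: adjoin_min => //; exact: valP.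
rewrite -EA -EK -ET; apply: mem_eq_fun => z; apply/idP/idP; last first.
  rewrite -ET' ET; apply: adjoin_min; rewrite ET' ?mem_residue //.
  by rewrite EK; exact: (residue_subE MS MA SV).2.
rewrite -EB; apply: (residue_subE MA MB AV).2; rewrite EA; apply: adjoin_min.
  by apply/(residue_subE MS MB SV); rewrite EB ET -EK; exact: adjoin_sub.
by rewrite -mem_residue // EB ET adjoin_mem.
Qed.

(** Intermediate rings are carried down by images and up by preimages, strictness being preserved
    both ways. *)
Lemma residue_intermediate (S S' : subringClosed Q) :
  {subset M <= S} -> {subset M <= S'} -> {subset S <= V} -> {subset S' <= V} ->
  has_intermediate_ring (residue locV S) (residue locV S') <->
  has_intermediate_ring S S'.
Proof.
move=> MS MS' SV SV'; split=> [[T]|[B [SB BS']]].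
  have [B [MB BV <-]] := residue_surj T.
  by rewrite !residue_psubset // => h; exists B.
have MB : {subset M <= B} by move=> m /MS /SB.1.
have BV : {subset B <= V} by move=> m /BS'.1 /SV'.
by have [T ET] := residue_subring B; exists T; rewrite ET !residue_psubset.
Qed.

Lemma residue_pointwise_minimal (S S' : subringClosed Q) :
  {subset M <= S} -> {subset M <= S'} -> {subset S <= V} -> {subset S' <= V} ->
  pointwise_minimal_extension (residue locV S) (residue locV S') <->
  pointwise_minimal_extension S S'.
Proof.
move=> MS MS' SV SV'.
rewrite /pointwise_minimal_extension residue_psubset //.
(* The larger ring downstairs is itself the residue of [S[v]], so minimality transfers one element
   at a time. *)
have minE v : minimal_extension (residue locV S) (adjoin (residue locV S) (pi v))
    <-> minimal_extension S (adjoin S (\val v)).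
  have [A EA] := adjoin_ring S (\val v).
  have SA : {subset S <= A} by rewrite EA; exact: adjoin_sub.
  have AV : {subset A <= V} by rewrite EA; apply: adjoin_min => //; exact: valP.
  have MA : {subset M <= A} by move=> m /MS /SA.
  rewrite -residue_adjoin // -EA /minimal_extension residue_psubset //.
  by rewrite residue_intermediate.
split=> -[ps h]; split=> // x.
- move=> xS' xS; apply/(minE (SubringOf (SV' _ xS')))/h; by rewrite mem_residue.
- case/residueP=> v vS' ->; rewrite mem_residue // => vS.
  by apply/minE/h.
Qed.

End ResidueCorrespondence.

(** Lifts equality of residues: each [x] in [V] is congruent modulo [M] to an integral [w], and
    [x - w], lying in [M] and so in [R], is integral too. *)
Lemma integral_closure_of_residue (Q : fieldType) (R V : subringClosed Q)
    (M : {pred Q}) (locV : local_with V M) :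
  {subset M <= R} -> {subset V <= qf R} ->
  residue locV (integral_closure R) =i residue locV V ->
  {subset V <= integral_closure R}.
Proof.
move=> MR VR RV x xV; apply/asboolP; split; first exact: VR.
have : \pi_({ideal_quot max_ideal locV}) (SubringOf xV) \in residue locV V.
  by apply/residueP; exists (SubringOf xV).
rewrite -RV => /residueP[w /asboolP[_ wI] /pi_eqP xw].
rewrite -[x](subrK (\val w)); apply: integral_add => //.
exact: (integral_id _ (SubringOf (MR _ xw))).
Qed.

(** * Equivalence of the four conditions *)

Theorem theorem2p12 (Q : fieldType) (R V : subringClosed Q) (M : {pred Q})
    (pvR : pseudo_valuation R) (locR : local_with R M)
    (valV : valuation_overring R V) (locV : local_with V M) :
  let R' := integral_closure R in
  let K := residue locV R in
  let L := residue locV R' in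
  let F := residue locV V in
  [<-> maximal_non_valuative_subring R V;
       maximal_non_valuative_domain R;
       [/\ R' =i V,
           psubset R R',
           ~ pointwise_minimal_extension R R' &
           forall S : subringClosed Q, psubset R S -> {subset S <= R'} ->
             S =i R' \/ pointwise_minimal_extension S R'];
       [/\ L =i F,
           psubset K L,
           ~ pointwise_minimal_extension K L &
           forall S : subringClosed (residue_ring locV),
             psubset K S -> {subset S <= L} ->
             S =i L \/ pointwise_minimal_extension S L]].
Proof.
move=> R' K L F.
have [maxR maxV] := (locR.1, locV.1); have [RV VR _] := valV.
have MR : {subset M <= R} by case: maxR => -[].
have MV : {subset M <= V} by case: maxV => -[].
tfae.
- exact: mnv_domain_of_mnv_subring maxV valV.
- exact: pointwise_minimal_of_mnv_domain maxR maxV valV.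
- move=> [R'V]; have R'E : integral_closure R = V by exact: mem_eq_fun.
  rewrite /K /L /F /R' R'E => RpV npm hS; split=> //.
  + exact/residue_psubset.
  + by move/residue_pointwise_minimal => /(_ MR MV RV (fun x => id)).
  (* Every subring of [V / M] is a residue, so the condition upstairs covers all of them. *)
  + move=> T; have [S [MS SV <-]] := residue_surj T.
    rewrite residue_psubset // => RS _.
    have [SV'|pm] := hS S RS SV; [left|right]; first exact/residue_inj.
    exact/residue_pointwise_minimal.
- move=> [LF KL npm hS].
  have R'V : R' =i V.
    move=> x; apply/idP/idP.
      exact: integral_closure_sub maxV valV _.
    exact: integral_closure_of_residue LF _.
  have R'E : integral_closure R = V by exact: mem_eq_fun.
  move: KL npm hS; rewrite /K /L /R' R'E => KL npm hS.
  apply: mnv_subring_of_pointwise_minimal maxR maxV valV _.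
  rewrite R'E; split=> //.
  + exact/(residue_psubset locV).
  + by move=> pm; apply: npm; exact/residue_pointwise_minimal.
  + move=> S RS SV; have MS : {subset M <= S} by move=> m /MR /RS.1.
    have [T ET] := residue_subring locV S.
    have [||TV|pm] := hS T.
    * by rewrite ET; exact/residue_psubset.
    * by rewrite ET; exact: (residue_subE locV MS MV SV).2.
    * by left; apply/(residue_inj locV MS MV SV) => // z; rewrite -TV ET.
    * by right; apply/(residue_pointwise_minimal locV MS MV SV); rewrite -?ET.
Qed.
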